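(* For a path graph $P_n$ with $n\ge 3$, $$Sb_2(P_n)=\begin{cases}2, & n\equiv 0 \pmod 3,\\ 3, & \text{otherwise.}\end{cases}$$
   Context: For a graph $G=(V,E)$, $\gamma(G)$ is its domination number (minimum size of a dominating set). For a positive integer $k$, $Sb_k(G)$ is the minimum size of a set $\mathcal{E}\subseteq E$ such that $\gamma(G-\mathcal{E})=\gamma(G)+k$. *)

(* Defs.v *)
From mathcomp Require Import all_boot.

Set Implicit Arguments.
Unset Strict Implicit.
Unset Printing Implicit Defensive.

Record sgraph := SGraph {
  vertex :> finType;
  adj : rel vertex;
  adj_sym : symmetric adj;
  adj_irrefl : irreflexive adj }.

(** Edges are the unordered pairs [[set x; y]] of adjacent vertices. *)
Definition edges (G : sgraph) : {set {set G}} :=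
  [set [set p.1; p.2] | p : G * G & adj p.1 p.2].

Section DeleteEdges.

Variables (G : sgraph) (F : {set {set G}}).

Definition del_adj : rel G := fun x y => adj x y && ([set x; y] \notin F).

Lemma del_adj_sym : symmetric del_adj.
Proof. by move=> x y; rewrite /del_adj adj_sym setUC. Qed.

Lemma del_adj_irrefl : irreflexive del_adj.
Proof. by move=> x; rewrite /del_adj adj_irrefl. Qed.

Definition del_edges : sgraph := SGraph del_adj_sym del_adj_irrefl.

End DeleteEdges.

Definition dominating (G : sgraph) (D : {set G}) : bool :=
  [forall v, (v \notin D) ==> [exists u in D, adj u v]].

Lemma dominating_setT (G : sgraph) : dominating [set: G].
Proof. by apply/forallP => v; rewrite inE. Qed.

(** The whole vertex set is dominating ([dominating_setT]), so the seed of
    [arg min] is admissible and the minimum is attained. *)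
Definition domination_number (G : sgraph) : nat :=
  #|[arg min_(D < [set: G] | dominating D) #|D| ]|.

Definition raises_by (k : nat) (G : sgraph) (F : {set {set G}}) : bool :=
  (F \subset edges G) &&
  (domination_number (del_edges F) == domination_number G + k).

(** [Sb k G] is [Some m] when [m] is the least size of a set of edges whose
    deletion raises the domination number by exactly [k], and [None] when there
    is no such set. *)
Definition Sb (k : nat) (G : sgraph) : option nat :=
  omap (fun F : {set {set G}} => #|F|)
    [pick F : {set {set G}} | raises_by k F &
       [forall F' : {set {set G}}, raises_by k F' ==> (#|F| <= #|F'|)]].

Section PathGraph.

Variable n : nat.

Definition path_adj : rel 'I_n :=
  fun i j => (i.+1 == j :> nat) || (j.+1 == i :> nat).

Lemma path_adj_sym : symmetric path_adj.
Proof. by move=> i j; rewrite /path_adj orbC. Qed.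

Lemma path_adj_irrefl : irreflexive path_adj.
Proof. by move=> i; rewrite /path_adj orbb gtn_eqF. Qed.

Definition path_graph : sgraph := SGraph path_adj_sym path_adj_irrefl.

End PathGraph.

(* Main.v *)
Require Import Defs.
From mathcomp Require Import all_boot.
From mathcomp Require Import zify.

(** A path piece on [a] vertices is dominated by [ceil(a/3) <= (a + 2)/3]
    vertices, so deleting [m] edges from [P_n] leaves a graph of domination
    number at most [(n + 2 + 2m)/3]; this gives the lower bounds on
    [Sb 2 (P_n)].  They are attained by cutting off isolated vertices from one
    end of the path: a dominating set contains all of them, and each of its
    other vertices dominates at most three vertices. *)

Lemma domination_number_le (G : sgraph) (D : {set G}) :
  dominating D -> domination_number G <= #|D|.
Proof.
move=> domD; rewrite /domination_number.
by case: arg_minnP => [|D' _]; [exact: dominating_setT | apply].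
Qed.

Lemma domination_number_witness (G : sgraph) :
  exists2 D : {set G}, dominating D & #|D| = domination_number G.
Proof.
rewrite /domination_number.
case: arg_minnP => [|D domD _]; first exact: dominating_setT.
by exists D.
Qed.

Lemma dominatingP (G : sgraph) (D : {set G}) :
  reflect (forall v, v \notin D -> exists2 u, u \in D & adj u v)
          (dominating D).
Proof.
apply: (iffP forallP) => domD v.
  by move=> vD; have /implyP/(_ vD)/exists_inP := domD v.
by apply/implyP => /domD/exists_inP.
Qed.

(** The set [F] rules out [None]. The set returned by [pick] need not be [F], but its minimality and
    the lower bound [m] force its cardinality to be [m]. *)
Lemma Sb_eq (k : nat) (G : sgraph) (F : {set {set G}}) (m : nat) :
  raises_by k F -> #|F| <= m ->
  (forall F' : {set {set G}}, raises_by k F' -> m <= #|F'|) ->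
  Sb k G = Some m.
Proof.
move=> raiseF Fm minm; rewrite /Sb; case: pickP => [F' | noF] /=.
  case/andP=> raiseF' /forallP/(_ F); rewrite raiseF /= => F'F.
  by congr Some; apply/eqP; rewrite eqn_leq minm // (leq_trans F'F).
have /negP[] := negbT (noF F); rewrite raiseF /=.
by apply/forallP => F'; apply/implyP => /minm; apply: leq_trans.
Qed.

Lemma edgesP (G : sgraph) (e : {set G}) :
  reflect (exists x y, adj x y /\ e = [set x; y]) (e \in edges G).
Proof.
apply: (iffP imsetP) => [[[x y]]|[x [y [xy ->]]]].
  by rewrite inE => xy ->; exists x, y.
by exists (x, y); rewrite ?inE.
Qed.

Lemma domination_number_le_del (G : sgraph) (F : {set {set G}}) :
  domination_number G <= domination_number (del_edges F).
Proof.
have [D /dominatingP domD <-] := domination_number_witness (del_edges F).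
apply: domination_number_le; apply/dominatingP => v vD.
by have [u uD /andP[uv _]] := domD v vD; exists u.
Qed.

(** An isolated vertex lies in every dominating set [D] and dominates only itself, while each vertex
    of [D :\: I] dominates at most [d.+1] vertices. Hence [#|G| <= #|I| + d.+1 * (#|D| - #|I|)]. *)
Lemma dominating_isolated_bound (G : sgraph) (d : nat) (I : {set G}) :
  (forall v : G, #|[set u | adj v u]| <= d) ->
  (forall u v : G, v \in I -> ~~ adj u v) ->
  #|G| + d * #|I| <= d.+1 * domination_number G.
Proof.
move=> deg isoI.
have [D /dominatingP domD <-] := domination_number_witness G.
have ID : I \subset D.
  apply/subsetP => v vI; apply/negPn/negP => /domD[u _].
  by apply/negP; exact: isoI.
have cover : [set: G] \subset
    I :|: \bigcup_(u in D :\: I) (u |: [set v | adj u v]).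
  apply/subsetP => v _; rewrite inE.
  case: (boolP (v \in I)) => //= vI; apply/bigcupP.
  case: (boolP (v \in D)) => [vD | /domD[u uD uv]].
    by exists v; rewrite !inE ?vI ?vD ?eqxx.
  exists u; rewrite !inE ?uv ?orbT // uD andbT.
  by apply/negP => uI; move: (isoI v u uI); rewrite adj_sym uv.
have bound :
    #|\bigcup_(u in D :\: I) (u |: [set v | adj u v])| <= d.+1 * #|D :\: I|.
  rewrite mulnC -sum_nat_const.
  have card_bigcup (A : {set G}) (f : G -> {set G}) :
      #|\bigcup_(u in A) f u| <= \sum_(u in A) #|f u|.
    apply: (big_ind2 (fun (B : {set G}) k => #|B| <= k)) => [|B k B' k' Bk Bk'|//].
      by rewrite cards0.
    by rewrite cardsU; apply: leq_trans (leq_subr _ _) (leq_add Bk Bk').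
  apply: leq_trans (card_bigcup _ _) _.
  apply: leq_sum => u _; rewrite cardsU1.
  by apply: (@leq_add _ _ 1 d) => //; case: (_ \notin _).
have := subset_leq_card cover; rewrite cardsT cardsU => Gle.
have cardDI : #|D| = #|I| + #|D :\: I| by rewrite -(cardsID I D) (setIidPr ID).
rewrite cardDI mulnDr mulSn; lia.
Qed.

Lemma path_degree (n : nat) (v : path_graph n) : #|[set u | adj v u]| <= 2.
Proof.
(* [insub] drops [v.+1] when it is out of range. At [v = 0] the entry [v.-1] is [v] itself, harmless
   since only an inclusion is used. *)
apply: (@leq_trans (size (pmap insub [:: v.-1; v.+1] : seq 'I_n))).
  apply: leq_trans (card_size _); apply: subset_leq_card.
  apply/subsetP => u; rewrite inE mem_pmap_sub !inE /= /path_adj; lia.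
by rewrite size_pmap; apply: leq_trans (count_size _ _) _.
Qed.

Lemma path_del_degree (n : nat) (F : {set {set path_graph n}})
    (v : del_edges F) : #|[set u | adj v u]| <= 2.
Proof.
apply: leq_trans (path_degree n v); apply: subset_leq_card.
by apply/subsetP => u; rewrite !inE => /andP[].
Qed.

(** Edges are indexed by their lower end; the order is written [n.+1] so that [inord] applies, and
    the edges are those with [k < n]. *)
Definition path_edge (n k : nat) : {set path_graph n.+1} :=
  [set inord k; inord k.+1].

Lemma path_adj_edge (n : nat) (u v : path_graph n.+1) :
  adj u v -> [set u; v] = path_edge n (minn u v).
Proof.
rewrite /path_edge => /orP[] /eqP uv; rewrite -uv.
  by rewrite (minn_idPl (leqnSn u)) uv !inord_val.
by rewrite (minn_idPr (leqnSn v)) uv !inord_val setUC.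
Qed.

Lemma path_edge_inj (n j k : nat) :
  j < n -> k < n -> path_edge n j = path_edge n k -> j = k.
Proof.
move=> jn kn /setP E.
(* Membership puts [j] in {k, k+1} and [k] in {j, j+1}, so [j = k]. *)
have := E (inord j); have := E (inord k).
rewrite !inE -!val_eqE /= !inordK; lia.
Qed.

Lemma path_edgesP (n : nat) (e : {set path_graph n.+1}) :
  reflect (exists2 k, k < n & e = path_edge n k)
          (e \in edges (path_graph n.+1)).
Proof.
apply: (iffP (edgesP _ _)) => [[x [y [xy ->]]] | [k kn ->]].
  exists (minn x y); last exact: path_adj_edge.
  by case/orP: xy => /eqP xy; rewrite -ltnS -xy; have := ltn_ord x;
     have := ltn_ord y; lia.
exists (inord k), (inord k.+1); split=> //=.
by rewrite /path_adj !inordK ?eqxx //; lia.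
Qed.

(** Induction on the length of the interval [[a, b)], whose inner edges have lower ends from [a] to
    [b - 2]. Splitting at a deleted edge adds one more rounding term 2, paid for by that edge's
    summand. Without a deleted edge, every third vertex suffices. *)
Lemma path_interval_dominated {n : nat} (F : {set {set path_graph n.+1}})
    {a b : nat} : a <= b <= n.+1 ->
  exists2 D : {set del_edges F},
    3 * #|D| <= b - a + 2 + 2 * \sum_(a <= k < b.-1) (path_edge n k \in F) &
    forall v : del_edges F, a <= v < b -> v \notin D ->
      exists2 u, u \in D & adj u v.
Proof.
have [m] := ubnP (b - a); elim: m a b => // m IHm a b bam /andP[ab bn].
case: (boolP [exists k : 'I_n, (a <= k < b.-1) && (path_edge n k \in F)]).
  case/existsP=> k /andP[/andP[ak kb] kF].
  have [||D1 card1 dom1] := IHm a k.+1; [lia | lia |].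
  have [||D2 card2 dom2] := IHm k.+1 b; [lia | lia |].
  exists (D1 :|: D2).
    rewrite (big_cat_nat (n := k)) /=; [|lia|lia].
    rewrite (big_ltn kb) kF.
    by rewrite cardsU; move: card1 card2; rewrite /=; lia.
  move=> v /andP[av vb]; rewrite inE negb_or => /andP[vD1 vD2].
  have [vk | kv] := leqP v k.
    have [|u uD uv] := dom1 v _ vD1; first by rewrite av.
    by exists u; rewrite // inE uD.
  have [|u uD uv] := dom2 v _ vD2; first by rewrite kv.
  by exists u; rewrite // inE uD orbT.
move=> uncut.
(* Centres of consecutive blocks of three vertices; the cap at [b.-1] keeps the last one inside the
   interval when its block has a single vertex. *)
pose c j := minn (a + 3 * j + 1) b.-1.
pose D := [set (inord (c j) : 'I_n.+1) | j : 'I_((b - a + 2) %/ 3)].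
exists D.
  have : #|D| <= (b - a + 2) %/ 3.
    by rewrite -[leqRHS]card_ord; apply: leq_imset_card.
  by move: #|D| => d; lia.
move=> v /andP[av vb] vD.
have ltj : (v - a) %/ 3 < (b - a + 2) %/ 3 by lia.
set u : 'I_n.+1 := inord (c ((v - a) %/ 3)).
have uD : u \in D by apply/imsetP; exists (Ordinal ltj).
have uE : u = c ((v - a) %/ 3) :> nat by rewrite inordK // /c; lia.
have neq_uv : u != v :> nat by apply: contraNneq vD => /val_inj <-.
have uv : path_adj u v.
  by move: neq_uv; rewrite /path_adj uE /c; lia.
exists u => //; rewrite /= /del_adj /= uv (path_adj_edge n _ _ uv) /=.
have ltn : minn u v < n.
  by have := ltn_ord u; have := ltn_ord v; move: uv; rewrite /path_adj; lia.
(* Both [u] and [v] lie in [[a, b)], so a deleted edge between them would be an inner deleted edge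
   of the interval. *)
apply: contra uncut => uvF; apply/existsP; exists (Ordinal ltn).
by rewrite uvF andbT /=; move: neq_uv; rewrite uE /c; lia.
Qed.

Lemma domination_number_path_del_edges {n : nat}
    (F : {set {set path_graph n.+1}}) :
  3 * domination_number (del_edges F) <= n + 3 + 2 * #|F|.
Proof.
have [|D cardD domD] := path_interval_dominated F (a := 0) (b := n.+1).
  by rewrite /=.
(* Distinct indices give distinct edges; only an inequality holds, since [F] may contain sets that
   are not edges. *)
have leF : \sum_(0 <= k < n) (path_edge n k \in F) <= #|F|.
  rewrite big_mkord.
  have -> : \sum_(k < n) (path_edge n k \in F)
      = #|[set k : 'I_n | path_edge n k \in F]|.
    by rewrite -sum1_card [RHS]big_mkcond; apply: eq_bigr => k _; rewrite inE;
       case: (_ \in F).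
  rewrite -(card_in_imset (f := fun k : 'I_n => path_edge n k)).
    by apply: subset_leq_card; apply/subsetP => _ /imsetP[k + ->]; rewrite inE.
  by move=> j k _ _ /path_edge_inj E; apply: val_inj; apply: E.
have : domination_number (del_edges F) <= #|D|.
  apply: domination_number_le; apply/dominatingP => v; apply: domD.
  exact: ltn_ord.
by move: cardD leF => /=; lia.
Qed.

Lemma domination_number_path_ge (n : nat) :
  n.+1 <= 3 * domination_number (path_graph n.+1).
Proof.
have iso0 (u v : path_graph n.+1) : v \in set0 -> ~~ adj u v by rewrite inE.
have := dominating_isolated_bound _ 2 set0 (path_degree n.+1) iso0.
by rewrite cards0 card_ord muln0 addn0.
Qed.

(** The value is the ceiling of [n.+1 / 3]. The upper bound comes from deleting [set0], carried back
    to the path by [domination_number_le_del]. *)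
Lemma domination_number_path (n : nat) :
  domination_number (path_graph n.+1) = (n + 3) %/ 3.
Proof.
have := domination_number_path_ge n.
have := domination_number_path_del_edges (n := n) set0.
have := domination_number_le_del (path_graph n.+1) set0.
rewrite cards0; lia.
Qed.

(** Deleting these edges isolates the vertices [0, ..., m - 1]. *)
Definition initial_edges (n m : nat) : {set {set path_graph n.+1}} :=
  [set path_edge n k | k : 'I_m].

Lemma initial_edges_sub {n m : nat} :
  m <= n -> initial_edges n m \subset edges (path_graph n.+1).
Proof.
move=> mn; apply/subsetP => _ /imsetP[k _ ->].
by apply/path_edgesP; exists k => //; apply: leq_trans mn.
Qed.

Lemma card_initial_edges (n m : nat) : #|initial_edges n m| <= m.
Proof. by rewrite -[leqRHS]card_ord; apply: leq_imset_card. Qed.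

Lemma domination_number_del_initial_edges {n m : nat} : m <= n ->
  n.+1 + 2 * m <= 3 * domination_number (del_edges (initial_edges n m)).
Proof.
move=> mn.
pose I := [set (inord k : 'I_n.+1) | k : 'I_m].
have cardI : #|I| = m.
  rewrite card_imset ?card_ord // => j k /(congr1 val).
  by rewrite /= !inordK => [/val_inj||] //; rewrite ltnS;
     apply: leq_trans (ltnW (ltn_ord _)) mn.
have isoI (u v : del_edges (initial_edges n m)) : v \in I -> ~~ adj u v.
  case/imsetP=> k _ vk; rewrite /= /del_adj; apply/negP => /andP[uv /negP[]].
  have vm : v < m by rewrite vk inordK //; have := ltn_ord k; lia.
  (* Every path edge at a vertex below [m] has its lower end below [m], hence is deleted. *)
  have ltm : minn u v < m by apply: leq_ltn_trans (geq_minr u v) vm.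
  by rewrite path_adj_edge //; apply/imsetP; exists (Ordinal ltm).
have := dominating_isolated_bound (del_edges (initial_edges n m)) 2 I
  (path_del_degree _ _) isoI.
by rewrite cardI card_ord.
Qed.

Theorem theorem3 (n : nat) (hn : 3 <= n) :
  Sb 2 (path_graph n) = Some (if n == 0 %[mod 3] then 2 else 3).
Proof.
case: n hn => // n hn; rewrite mod0n.
set m := if _ then _ else _.
(* The path now has [n.+1] vertices and [n] edges. Order 3 falls in the case [m = 2], so [m = 3]
   occurs only with at least three edges. *)
have mn : m <= n by rewrite /m; case: eqP; lia.
apply: (Sb_eq _ _ (initial_edges n m)) (card_initial_edges _ _) _ => [|F].
  apply/andP; split; first exact: initial_edges_sub.
  (* Three times the new domination number lies between [n + 1 + 2m] and [n + 3 + 2m], which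
     contains one multiple of 3; in each residue class it gives an increase of exactly 2. *)
  have := domination_number_del_initial_edges mn.
  have := domination_number_path_del_edges (initial_edges n m).
  have := card_initial_edges n m.
  by rewrite domination_number_path /m; case: eqP; lia.
case/andP=> _ /eqP raiseF.
(* An increase of 2 requires [3 * ((n + 3) %/ 3) + 6 <= n + 3 + 2 * #|F|], hence [#|F| >= m] in each
   residue class. *)
have := domination_number_path_del_edges F.
by rewrite raiseF domination_number_path /m; case: eqP; lia.
Qed.
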